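(* Let $m, r_1, r_2 \ge 1$ be integers, let $\mathcal{T}^1$ be a type space with $r_1$ entries in $\mathbb{R}^m$, and let $\mathcal{T}^2$ be a type space with $r_2$ entries in $\mathbb{R}^m$. Then for every $g \in \mathrm{IC}(\mathcal{T}^1, \mathcal{T}^2)$ there exists a type space $\mathcal{S}^2$ with $r_2$ entries in $\mathbb{R}^m$ such that $g$ is an affine maximizer on $\mathcal{T}^1 \times \mathcal{S}^2$, i.e. $g \in \mathrm{AM}(\mathcal{T}^1, \mathcal{S}^2)$.
   Context: Write $[m]=\{1,\dots,m\}$. A (single-player) type space with $r$ entries is an ordered tuple $\mathcal{T}=(\mathcal{T}_1,\dots,\mathcal{T}_r)$ of vectors in $\mathbb{R}^m$; its type matrix $T\in\mathbb{R}^{r\times m}$ has these vectors as rows, in the same order. Let $\mathcal{T}^1,\dots,\mathcal{T}^n$ be type spaces in $\mathbb{R}^m$ with $r_1,\dots,r_n$ entries and type matrices $T^1,\dots,T^n$. An outcome function $g$ on $\mathcal{T}^1\times\cdots\times\mathcal{T}^n$ is identified with a tensor $g\in[m]^{r_1\times\cdots\times r_n}$, i.e. a function $[r_1]\times\cdots\times[r_n]\to[m]$, $g(i_1,\dots,i_n)$ being the outcome when player $j$ declares the $i_j$-th entry of $\mathcal{T}^j$. Incentive compatibility: $g$ is IC on $\mathcal{T}^1\times\cdots\times\mathcal{T}^n$ if there is a payment function $p:[r_1]\times\cdots\times[r_n]\to\mathbb{R}^n$ such that for every player $j\in[n]$, every $(i_1,\dots,i_n)$, and every $l\in[r_j]$,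 $$T^j_{i_j,\,g(i_1,\dots,i_n)}-p(i_1,\dots,i_n)_j\ \ge\ T^j_{i_j,\,g(i_1,\dots,i_{j-1},l,i_{j+1},\dots,i_n)}-p(i_1,\dots,i_{j-1},l,i_{j+1},\dots,i_n)_j .$$ $\mathrm{IC}(\mathcal{T}^1,\dots,\mathcal{T}^n)\subseteq[m]^{r_1\times\cdots\times r_n}$ denotes the set of all IC outcome functions; the case $n=1$ defines $\mathrm{IC}(\mathcal{T})\subseteq[m]^r$ for a single type space. Affine maximizers: for $\alpha_1,\dots,\alpha_n>0$ and $\gamma\in\mathbb{R}^m$, let $M(\alpha_1\mathcal{T}^1,\dots,\alpha_n\mathcal{T}^n,\gamma)$ be the single-player type space with $\prod_j r_j$ entries, indexed lexicographically by $(i_1,\dots,i_n)$, whose $(i_1,\dots,i_n)$-th entry is $\alpha_1\mathcal{T}^1_{i_1}+\cdots+\alpha_n\mathcal{T}^n_{i_n}+\gamma$. The outcome function $g$ is an affine maximizer on $\mathcal{T}^1\times\cdots\times\mathcal{T}^n$ if there exist $\alpha_1,\dots,\alpha_n>0$ and $\gamma\in\mathbb{R}^m$ such that $g$, viewed as a vector indexed by the tuples $(i_1,\dots,i_n)$, belongs to the single-player set $\mathrm{IC}(M(\alpha_1\mathcal{T}^1,\dots,\alpha_n\mathcal{T}^n,\gamma))$. The set of all affine maximizers is $\mathrm{AM}(\mathcal{T}^1,\dots,\mathcal{T}^n)$. *)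

(* Defs.v *)
From mathcomp Require Import all_boot all_order all_algebra reals.

Set Implicit Arguments.
Unset Strict Implicit.
Unset Printing Implicit Defensive.

Import Order.TTheory GRing.Theory Num.Theory.
Local Open Scope ring_scope.

(* A family of entries of R^m; a type space with r entries is the case I = 'I_r.
   General finite index types are allowed because the type space
   M(alpha_1 T^1, ..., alpha_n T^n, gamma) below has one entry per tuple
   (i_1, ..., i_n); its entries are indexed by the tuples themselves rather than
   by their lexicographic ranks, as IC does not involve the order of entries. *)
Definition type_space (R : realType) (m : nat) (I : finType) : Type :=
  I -> 'rV[R]_m.

Definition profile (n : nat) (I : 'I_n -> finType) : finType :=
  {dffun forall j : 'I_n, I j}.

Definition outcome_function (m n : nat) (I : 'I_n -> finType) : Type :=
  profile I -> 'I_m.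

(* (i_1, ..., i_{j-1}, l, i_{j+1}, ..., i_n) *)
Definition deviate (n : nat) (I : 'I_n -> finType)
    (i : profile I) (j : 'I_n) (l : I j) : profile I :=
  finfun (dfwith (fun k => i k) l).

Definition IC (R : realType) (m n : nat) (I : 'I_n -> finType)
    (T : forall j, type_space R m (I j)) (g : outcome_function m I) : Prop :=
  exists p : profile I -> 'rV[R]_n,
    forall (j : 'I_n) (i : profile I) (l : I j),
      T j (i j) ord0 (g i) - p i ord0 j >=
      T j (i j) ord0 (g (deviate i l)) - p (deviate i l) ord0 j.

(* The set IC(S) of a single type space S: the case of one player. *)
Definition IC1 (R : realType) (m : nat) (I : finType)
    (S : type_space R m I) (g : I -> 'I_m) : Prop :=
  @IC R m 1 (fun _ => I) (fun _ => S) (fun i => g (i ord0)).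

Definition M (R : realType) (m n : nat) (I : 'I_n -> finType)
    (T : forall j, type_space R m (I j)) (alpha : 'I_n -> R)
    (gamma : 'rV[R]_m) : type_space R m (profile I) :=
  fun i => \sum_(j < n) alpha j *: T j (i j) + gamma.

Definition AM (R : realType) (m n : nat) (I : 'I_n -> finType)
    (T : forall j, type_space R m (I j)) (g : outcome_function m I) : Prop :=
  exists (alpha : 'I_n -> R) (gamma : 'rV[R]_m),
    (forall j, 0 < alpha j) /\ IC1 (M T alpha gamma) g.

(* Two-player families: player ord0 has entries in I1, the other one in I2. *)
Definition index2 (I1 I2 : finType) (j : 'I_2) : finType :=
  if j == ord0 then I1 else I2.

Definition types2 (R : realType) (m : nat) (I1 I2 : finType)
    (T1 : type_space R m I1) (T2 : type_space R m I2) (j : 'I_2) :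
    type_space R m (index2 I1 I2 j) :=
  if j == ord0 as b return type_space R m (if b then I1 else I2)
  then T1 else T2.

(* Main.v *)
Require Import Defs.
From mathcomp Require Import all_boot all_order all_algebra reals.

(** If the type of player 2 is fixed to b, player 1 faces a one-player
    incentive compatible rule.  The payments of such a rule amount to a price
    vector on the outcomes at which every type a of player 1 (weakly) prefers
    the outcome g(a, b) it is assigned.  Lemma [supporting_rowP] obtains prices
    on all m outcomes, including those that g(-, b) never selects.  Taking minus
    these prices as the b-th entry of S2 makes g(a, b) a maximizer of
    T1_a + S2_b over all outcomes, so g is a maximizer of the unweighted sum
    (alpha_1 = alpha_2 = 1, gamma = 0) and is incentive compatible for the
    single-player type space M with zero payments.  *)

Set Implicit Arguments.
Unset Strict Implicit.
Unset Printing Implicit Defensive.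

Import Order.TTheory GRing.Theory Num.Theory.
Local Open Scope ring_scope.

Definition truthful_utility (R : realType) (m : nat) (I : finType)
    (T : type_space R m I) (f : I -> 'I_m) (p : I -> R) (i : I) : R :=
  T i ord0 (f i) - p i.

(** Minus the cheapest prices at which no type can beat its truthful utility:
    the conjugate of the truthful utility with respect to the valuation [T].
    The type [i0] provides the default value of the iterated minimum. *)
Definition supporting_row (R : realType) (m : nat) (I : finType) (i0 : I)
    (T : type_space R m I) (f : I -> 'I_m) (p : I -> R) : 'rV[R]_m :=
  \row_x \big[Num.min/truthful_utility T f p i0 - T i0 ord0 x]_i
    (truthful_utility T f p i - T i ord0 x).

(** With these prices type [i] gets at most its truthful utility from every
    outcome [x], since [i] takes part in the minimum; it gets at least that
    utility from [f i], since by incentive compatibility every term of the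
    minimum at [f i] is at least [- p i]. *)
Lemma supporting_rowP (R : realType) (m : nat) (I : finType) (i0 : I)
    (T : type_space R m I) (f : I -> 'I_m) (p : I -> R) :
  (forall i l, T i ord0 (f l) - p l <= T i ord0 (f i) - p i) ->
  forall i x, (T i + supporting_row i0 T f p) ord0 x <=
              (T i + supporting_row i0 T f p) ord0 (f i).
Proof.
move=> icT i x; rewrite !mxE.
apply: (@le_trans _ _ (truthful_utility T f p i)).
  by rewrite -lerBrDl bigmin_le.
have ge_price k :
    - p i <= truthful_utility T f p k - T k ord0 (f i).
  by rewrite lerBrDl; apply: icT.
by rewrite lerD2l; apply: le_bigmin => [|k _]; apply: ge_price.
Qed.

Definition pair_profile (I1 I2 : finType) (a : I1) (b : I2) :
    profile (index2 I1 I2) :=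
  [ffun j => if j == ord0 as c return (if c then I1 else I2) then a else b].

Lemma pair_profile_eta (I1 I2 : finType) (i : profile (index2 I1 I2)) :
  pair_profile (i ord0) (i (lift ord0 ord0)) = i.
Proof.
apply/ffunP => j; rewrite ffunE.
by case: (unliftP ord0 j) => [k|] ->; rewrite ?(ord1 k).
Qed.

Lemma pair_profile0 (I1 I2 : finType) (a : I1) (b : I2) :
  pair_profile a b ord0 = a.
Proof. by rewrite ffunE. Qed.

Lemma deviate_pair_profile0 (I1 I2 : finType) (a a' : I1) (b : I2) :
  deviate (pair_profile a b) (j := ord0) a' = pair_profile a' b.
Proof.
apply/ffunP => j; rewrite !ffunE.
case: (unliftP ord0 j) => [k|] ->; last by rewrite dfwith_in.
by rewrite dfwith_out // ffunE (ord1 k).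
Qed.

(** Zero payments are incentive compatible for a rule that always selects a
    best outcome. *)
Lemma IC1_maximizer (R : realType) (m : nat) (I : finType)
    (S : type_space R m I) (g : I -> 'I_m) :
  (forall i x, S i ord0 x <= S i ord0 (g i)) -> IC1 S g.
Proof.
move=> maxg; exists (fun=> 0) => j i l.
by rewrite (ord1 j) !mxE lerB.
Qed.

Theorem theorem1p1 (R : realType) (m r1 r2 : nat)
    (hm : (1 <= m)%N) (hr1 : (1 <= r1)%N) (hr2 : (1 <= r2)%N)
    (T1 : type_space R m 'I_r1) (T2 : type_space R m 'I_r2)
    (g : outcome_function m (index2 'I_r1 'I_r2)) :
  IC (types2 T1 T2) g ->
  exists S2 : type_space R m 'I_r2, AM (types2 T1 S2) g.
Proof.
move=> [p icg]; pose prof := @pair_profile 'I_r1 'I_r2.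
pose S2 b := supporting_row (Ordinal hr1) T1
  (fun a => g (prof a b)) (fun a => p (prof a b) ord0 ord0).
exists S2, (fun=> 1), 0; split=> [j|]; first exact: ltr01.
apply: IC1_maximizer => i x.
rewrite -(pair_profile_eta i).
move: (i ord0) (i (lift ord0 ord0)) => a b.
have -> : M (types2 T1 S2) (fun=> 1) 0 (prof a b) = T1 a + S2 b.
  by rewrite /M addr0 big_ord_recl big_ord1 !scale1r !ffunE.
apply: supporting_rowP => {}a l.
have := icg ord0 (prof a b) l.
by rewrite deviate_pair_profile0 pair_profile0.
Qed.
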